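(* Let $A$ and $B$ be commutative rings with unity, $f: A\to B$ a ring homomorphism, and $J$ an ideal of $B$. Let $A\Join^f J := \{(a, f(a)+j) \mid a\in A,\ j\in J\}$ (a subring of $A\times B$), $J_0 := \{0\}\times J$, $U := \operatorname{Spec}(B)\setminus V(J)$, $\mathcal{Y}_{(f,J)} := \{Q\in U \mid f^{-1}(Q+J)=\{0\}\}$ and $\delta_{(f,J)} := \dim(\mathcal{Y}_{(f,J)})$. For $Q\in\operatorname{Spec}(B)$ put $\overline{Q}^{f} := (A\times Q)\cap (A\Join^f J)$, and for $P\in\operatorname{Spec}(A)$ put $P^{\prime_f} := \{(p, f(p)+j)\mid p\in P,\ j\in J\}$. Then: (1) For every $Q\in\operatorname{Spec}(B)$, $f^{-1}(Q+J)=\{0\}$ if and only if $\overline{Q}^{f}\subseteq J_0$. (2) For every $Q\in\mathcal{Y}_{(f,J)}$, the prime ideal $\overline{Q}^{f}$ of $A\Join^f J$ is contained in every prime ideal of $A\Join^f J$ of the form $P^{\prime_f}$, with $P\in\operatorname{Spec}(A)$. (3) $\max\{\dim(U),\ \dim(A)+1+\delta_{(f,J)}\}\le \dim(A\Join^f J)$.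
   Context: All rings are commutative with unity and ring homomorphisms preserve the unity. $\dim$ of a ring is its Krull dimension (possibly $\infty$). $V(J)$ is the set of prime ideals of $B$ containing $J$. For a set $S$ of prime ideals, $\dim(S)$ is the supremum of the lengths $r$ of chains $Q_0\subsetneq Q_1\subsetneq\dots\subsetneq Q_r$ of primes belonging to $S$, with the convention $\dim(\emptyset)=-1$. The set $\mathcal{Y}_{(f,J)}$ is stable under generizations in $\operatorname{Spec}(B)$, so $\delta_{(f,J)}=\sup\{\operatorname{ht}_B(Q)\mid Q\in\mathcal{Y}_{(f,J)}\}$ (equal to $-1$ if the set is empty). *)

(* Defs.v *)
From HB Require Import structures.
From mathcomp Require Import all_boot all_order all_algebra.
From mathcomp Require Import boolp classical_sets constructive_ereal.

Set Implicit Arguments.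
Unset Strict Implicit.
Unset Printing Implicit Defensive.

Import Order.TTheory GRing.Theory Num.Theory.

Local Open Scope classical_set_scope.
Local Open Scope ring_scope.

(* The library's [idealr] and [prime_idealr] force an ideal to be proper and
   the ring to be nonzero.  Here J may be the unit ideal and the rings may be
   zero, so ideals are taken as subsets of a [comPzRingType]. *)
Definition is_ideal (R : comPzRingType) (I : set R) : Prop :=
  [/\ I 0, forall x y, I x -> I y -> I (x + y) & forall a x, I x -> I (a * x)].

Definition is_prime_ideal (R : comPzRingType) (P : set R) : Prop :=
  [/\ is_ideal P, ~ P 1 & forall x y, P (x * y) -> P x \/ P y].

Record ideal (R : comPzRingType) := Ideal {
  ideal_set :> set R;
  ideal_setP : is_ideal ideal_set }.

Definition ideal_sum (R : comPzRingType) (I J : set R) : set R :=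
  [set x + y | x in I & y in J].

Definition Spec (R : comPzRingType) : set (set R) :=
  [set P | is_prime_ideal P].
Arguments Spec R : clear implicits.

Definition Vset (R : comPzRingType) (J : set R) : set (set R) :=
  [set P | Spec R P /\ J `<=` P].

(* Q_0 < Q_1 < ... < Q_r; the values of Q beyond r are irrelevant. *)
Definition is_chain (R : comPzRingType) (S : set (set R)) (r : nat)
    (Q : nat -> set R) : Prop :=
  (forall i, (i <= r)%N -> S (Q i)) /\
  (forall i, (i < r)%N -> Q i `<` Q i.+1).

Definition chain_lengths (R : comPzRingType) (S : set (set R)) :
    set (\bar int) :=
  [set r%:Z%:E | r in [set r : nat | exists Q, is_chain S r Q]].

(* The first argument of [supremum] is its value on the empty set: this is the
   convention dim(empty) = -1.  It would also be the value on a set without a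
   supremum, a case excluded by [chain_lengths_supremum] below. *)
Definition chain_dim (R : comPzRingType) (S : set (set R)) : \bar int :=
  supremum (- 1%:E)%E (chain_lengths S).

Definition krull_dim (R : comPzRingType) : \bar int := chain_dim (Spec R).

Lemma chain_lengths_supremum (R : comPzRingType) (S : set (set R)) :
  chain_lengths S !=set0 -> supremums (chain_lengths S) !=set0.
Proof.
move=> [_ [r0 Lr0 _]].
set L := [set r : nat | exists Q, is_chain S r Q] in Lr0 *.
have [[n ubL]|noubL] := pselect (exists n : nat, ubound L n).
  have exL : exists r, `[< L r >] by exists r0; apply/asboolP.
  have leL r : `[< L r >] -> (r <= n)%N by move=> /asboolP /ubL.
  case: (ex_maxnP exL leL) => r /asboolP Lr rmax.
  exists r%:Z%:E; split; last by move=> y; apply; exists r.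
  by move=> _ [s Ls <-]; rewrite lee_fin lez_nat; apply/rmax/asboolP.
exists +oo%E; split; first by move=> x _; exact: leey.
move=> [y||] uby //.
- exfalso; apply: noubL; exists `|y|%N => r Lr.
  have : (r%:Z%:E <= y%:E)%E by apply: uby; exists r.
  by rewrite lee_fin leEnat -lez_nat => /le_trans; apply; exact: lez_abs.
- by have := uby r0%:Z%:E; apply; exists r0.
Qed.

Section Amalgamation.
Variables (A B : comPzRingType) (f : {rmorphism A -> B}) (J : ideal B).

Definition amalgam_set : set (A * B) :=
  [set (a, f a + j) | a in [set: A] & j in J].

Lemma amalgam_subring_closed : subring_closed (mem amalgam_set).
Proof.
have [J0 JD JM] := ideal_setP J.
have JN x : ideal_set J x -> ideal_set J (- x).
  by move=> Jx; rewrite -mulN1r; exact: JM.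
split=> [|x y|x y]; rewrite ?inE.
- by exists 1 => //; exists 0; rewrite // rmorph1 addr0.
- move=> [a _ [j Jj <-]] [b _ [k Jk <-]].
  exists (a - b) => //; exists (j - k); first by apply: JD => //; exact: JN.
  have -> : f (a - b) + (j - k) = f a + j - (f b + k).
    by rewrite rmorphB addrACA opprD.
  by [].
- move=> [a _ [j Jj <-]] [b _ [k Jk <-]].
  exists (a * b) => //; exists (f a * k + j * (f b + k)).
    by apply: JD; [|rewrite mulrC]; exact: JM.
  have -> : f (a * b) + (f a * k + j * (f b + k)) = (f a + j) * (f b + k).
    by rewrite rmorphM mulrDl !mulrDr addrA.
  by [].
Qed.

Definition amalgam : Type := {x : A * B | x \in amalgam_set}.

HB.instance Definition _ := SubChoice.on amalgam.
HB.instance Definition _ :=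
  GRing.SubChoice_isSubComPzRing.Build (A * B)%type (mem amalgam_set) amalgam
    amalgam_subring_closed.

Definition amalgam_J0 : set amalgam := val @^-1` ([set 0] `*` J).

Definition specU : set (set B) := Spec B `\` Vset J.

Definition specY : set (set B) :=
  [set Q | specU Q /\ f @^-1` (ideal_sum Q J) = [set 0]].

Definition delta : \bar int := chain_dim specY.

Definition Qbar (Q : set B) : set amalgam :=
  val @^-1` (([set: A] `*` Q) `&` amalgam_set).

Definition Pprime (P : set A) : set amalgam :=
  val @^-1` [set (p, f p + j) | p in P & j in J].

End Amalgamation.

Arguments amalgam_J0 {A B} f J.
Arguments Qbar {A B} f J Q.
Arguments Pprime {A B} f J P.

(* Main.v *)
(* The two projections of the amalgamation pull primes of B and of A back to
   primes [Qbar Q] and [Pprime P].  On primes not containing J the map [Qbar]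
   is strictly increasing, and [Pprime] is strictly increasing everywhere.  If
   Q lies in [specY], then [Qbar Q] is contained in J_0, which is contained in
   every [Pprime P], and properly so because Q does not contain J.  Hence a
   chain of length s in [specY] followed by a chain of length r of primes of A
   yields a chain of length s + 1 + r. *)
Require Import Defs.
From HB Require Import structures.
From mathcomp Require Import all_boot all_order all_algebra.
From mathcomp Require Import boolp classical_sets constructive_ereal zify.

Set Implicit Arguments.
Unset Strict Implicit.
Unset Printing Implicit Defensive.

Import Order.TTheory GRing.Theory Num.Theory.

Local Open Scope classical_set_scope.
Local Open Scope ring_scope.

Lemma Spec_preimage (R S : comPzRingType) (g : {rmorphism R -> S})
    (P : set S) : Spec S P -> Spec R (g @^-1` P).
Proof.
move=> [[P0 PD PM] P1 PP]; split; first split.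
- by rewrite /preimage /= rmorph0.
- by move=> x y Px Py; rewrite /preimage /= rmorphD; exact: PD.
- by move=> a x Px; rewrite /preimage /= rmorphM; exact: PM.
- by rewrite /preimage /= rmorph1.
- by move=> x y; rewrite /preimage /= rmorphM; exact: PP.
Qed.

(** * Chains of primes and the supremum of their lengths *)

Section ChainDim.
Variable R : comPzRingType.
Implicit Type S : set (set R).

(** The link from [Q s] to [P 0] is itself a step, which accounts for the successor in
    [s.+1 + r]. *)
Lemma is_chain_cat S (s r : nat) (Q P : nat -> set R) :
  is_chain S s Q -> is_chain S r P -> Q s `<` P 0 ->
  is_chain S (s.+1 + r) (fun i => if (i <= s)%N then Q i else P (i - s.+1)%N).
Proof.
move=> [SQ ltQ] [SP ltP] ltQP; split=> i ir.
  by case: leqP => [/SQ//|si]; apply: SP; rewrite leq_subLR.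
case: (ltngtP i s) => [/ltQ//|si|->]; last by rewrite subnn.
by rewrite subSn//; apply: ltP; rewrite ltn_subLR.
Qed.

Lemma chain_dim_ge S (r : nat) (Q : nat -> set R) :
  is_chain S r Q -> (r%:Z%:E <= chain_dim S)%E.
Proof.
move=> SQ; have Lr : chain_lengths S r%:Z%:E by exists r => //; exists Q.
apply: ge_supremum_Nmem => //; apply: chain_lengths_supremum.
by exists r%:Z%:E.
Qed.

(** The hypothesis on [- 1%:E] covers a set without chains, where the supremum takes its default
    value. *)
Lemma chain_dim_le S (y : \bar int) :
  (- 1%:E <= y)%E -> (forall r Q, is_chain S r Q -> (r%:Z%:E <= y)%E) ->
  (chain_dim S <= y)%E.
Proof.
move=> y1 uby; have [L0|/set0P L0] := eqVneq (chain_lengths S) set0.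
  by rewrite /chain_dim L0 supremum0.
rewrite /chain_dim /supremum; case: ifP => // _.
case: xgetP => [_ -> [_]|/(_ _)]; last by have [z] := chain_lengths_supremum L0.
by apply=> _ [r [Q SQ] <-]; exact: uby SQ.
Qed.

Lemma chain_dim_geN1 S : (- 1%:E <= chain_dim S)%E.
Proof.
have [L0|/set0P [_ [r [Q SQ] _]]] := eqVneq (chain_lengths S) set0.
  by rewrite /chain_dim L0 supremum0.
by apply: le_trans (chain_dim_ge SQ); rewrite lee_fin.
Qed.

Lemma is_chain0 S (Q : set R) : S Q -> is_chain S 0 (fun=> Q).
Proof. by move=> SQ; split. Qed.

Lemma chain_dim0 : chain_dim (@set0 (set R)) = (- 1%:E)%E.
Proof.
by apply/le_anti; rewrite chain_dim_geN1 chain_dim_le// => r Q [/(_ 0 isT)].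
Qed.

End ChainDim.

Lemma is_chain_map (R R' : comPzRingType) (S : set (set R))
    (T : set (set R')) (F : set R -> set R') :
  (forall Q, S Q -> T (F Q)) ->
  (forall Q Q', S Q -> S Q' -> Q `<` Q' -> F Q `<` F Q') ->
  forall r Q, is_chain S r Q -> is_chain T r (F \o Q).
Proof.
move=> FT Flt r Q [SQ ltQ]; split=> [i ir|i ir]; first exact/FT/SQ.
by apply: Flt; [exact/SQ/ltnW|exact: SQ|exact: ltQ].
Qed.

Lemma chain_dim_mono (R R' : comPzRingType) (S : set (set R))
    (T : set (set R')) (F : set R -> set R') :
  (forall Q, S Q -> T (F Q)) ->
  (forall Q Q', S Q -> S Q' -> Q `<` Q' -> F Q `<` F Q') ->
  (chain_dim S <= chain_dim T)%E.
Proof.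
move=> FT Flt; apply: chain_dim_le (chain_dim_geN1 T) _ => r Q SQ.
exact: chain_dim_ge (is_chain_map FT Flt SQ).
Qed.

(** The bound on sums of lengths passes to the suprema one at a time: first over chains of [S] with
    a chain of [S'] fixed, then over chains of [S']. *)
Lemma chain_dim_add_le (R R' R'' : comPzRingType) (S : set (set R))
    (S' : set (set R')) (T : set (set R'')) :
  S !=set0 -> S' !=set0 ->
  (forall r s P Q, is_chain S r P -> is_chain S' s Q ->
     exists C, is_chain T (s.+1 + r) C) ->
  (chain_dim S + 1 + chain_dim S' <= chain_dim T)%E.
Proof.
move=> [P0 SP0] [Q0 SQ0] cat.
have := chain_dim_geN1 T.
case ET : (chain_dim T) => [t| |] // _; last by rewrite leey.
have bnd r s P Q : is_chain S r P -> is_chain S' s Q ->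
    (r%:Z + 1 + s%:Z <= t)%R.
  move=> cP cQ; have [C /chain_dim_ge] := cat _ _ _ _ cP cQ.
  rewrite ET lee_fin; lia.
have bndS s Q : is_chain S' s Q -> (chain_dim S <= (t - 1 - s%:Z)%:E)%E.
  move=> cQ; apply: chain_dim_le => [|r P cP]; rewrite lee_fin.
    by have := bnd _ _ _ _ (is_chain0 SP0) cQ; lia.
  by have := bnd _ _ _ _ cP cQ; lia.
(* Chains of length 0 on both sides force [chain_dim S] to be an integer [d >= 0], so it can be
   subtracted. *)
have := bndS _ _ (is_chain0 SQ0); have := chain_dim_ge (is_chain0 SP0).
case ES : (chain_dim S) => [d| |] // d0 dt.
have : (chain_dim S' <= (t - 1 - d)%:E)%E.
  apply: chain_dim_le => [|s Q /bndS]; move: d0 dt; rewrite ?ES !lee_fin; lia.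
have := chain_dim_geN1 S'.
case: (chain_dim S') => [e| |] // _.
rewrite -!EFinD !lee_fin; lia.
Qed.

(** * Primes of the amalgamation *)

Section Amalgam.
Variables (A B : comPzRingType) (f : {rmorphism A -> B}) (J : ideal B).
Implicit Types (P : set A) (Q : set B) (x : amalgam f J).

Lemma amalgam_setP a j : ideal_set J j -> (a, f a + j) \in amalgam_set f J.
Proof. by move=> Jj; rewrite inE; exists a => //; exists j. Qed.

Definition amalgam_elt a j (Jj : ideal_set J j) : amalgam f J :=
  Sub (a, f a + j) (amalgam_setP a Jj).

Lemma amalgamP x : exists a j (Jj : ideal_set J j), x = amalgam_elt a Jj.
Proof.
have := valP x; rewrite inE => -[a _ [j Jj xE]].
by exists a, j, Jj; apply/val_inj; rewrite /= -xE.
Qed.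

(** Membership in the amalgamation is automatic for its elements, so only the second projection
    matters; primality then follows from [Spec_preimage]. *)
Lemma QbarE Q : Qbar f J Q = (snd \o val) @^-1` Q.
Proof.
apply/seteqP; split=> x; first by move=> [[]].
by move=> Qx; split; [split|have := valP x; rewrite inE].
Qed.

Lemma PprimeE P : Pprime f J P = (fst \o val) @^-1` P.
Proof.
apply/seteqP; split=> x.
  by rewrite /Pprime /preimage /= => -[a Pa [j _ <-]].
have [a [j [Jj ->]]] := amalgamP x => Pa.
by exists a => //; exists j.
Qed.

Lemma Spec_Qbar Q : Spec B Q -> Spec (amalgam f J) (Qbar f J Q).
Proof.
by rewrite QbarE; exact: (Spec_preimage (snd \o val : {rmorphism _ -> _})).
Qed.

Lemma Spec_Pprime P : Spec A P -> Spec (amalgam f J) (Pprime f J P).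
Proof.
by rewrite PprimeE; exact: (Spec_preimage (fst \o val : {rmorphism _ -> _})).
Qed.

(** An element [a] lies in the preimage of [Q + J] exactly when [f a + j] is in [Q] for some [j] in
    [J], that is, when [a] is the first coordinate of an element of [Qbar f J Q]. *)
Lemma Qbar_subset_J0 Q : Spec B Q ->
  f @^-1` (ideal_sum Q J) = [set 0] <-> Qbar f J Q `<=` amalgam_J0 f J.
Proof.
move=> [[Q0 _ QM] _ _]; have [J0 _ JM] := ideal_setP J.
have JN j : ideal_set J j -> ideal_set J (- j).
  by move=> Jj; rewrite -mulN1r; exact: JM.
rewrite QbarE; split=> [fQJ x|QJ0].
  have [a [j [Jj ->]]] := amalgamP x => /= Qaj.
  have a0 : a = 0.
    suff : (f @^-1` (ideal_sum Q J)) a by rewrite fQJ.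
    by exists (f a + j) => //; exists (- j); [exact: JN|rewrite addrK].
  by split; rewrite /= a0// rmorph0 add0r.
apply/seteqP; split=> [a [q Qq [j Jj qjE]]|_ ->]; last first.
  by exists 0 => //; exists 0 => //; rewrite addr0 rmorph0.
(* From [f a = q + j], the pair [(a, f a - j) = (a, q)] lies in [Qbar f J Q]. *)
have [] // := QJ0 (amalgam_elt a (JN _ Jj)).
by rewrite /preimage /= -qjE addrK.
Qed.

Lemma J0_subset_Pprime P : Spec A P -> amalgam_J0 f J `<=` Pprime f J P.
Proof.
move=> [[P0 _ _] _ _]; rewrite PprimeE => x [/= x0 _].
by rewrite /preimage /= x0.
Qed.

Lemma specU_witness Q : specU J Q -> exists2 j, ideal_set J j & ~ Q j.
Proof.
move=> [SQ nV]; apply: contrapT => H; apply: nV; split=> // j Jj.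
by apply: contrapT => nQj; apply: H; exists j.
Qed.

(* Multiplying by some [j] in [J] outside [Q] pushes an element of [Q'] outside
   [Q] into [J], hence into the second component of the amalgamation. *)
Lemma Qbar_proper Q Q' : specU J Q -> specU J Q' -> Q `<` Q' ->
  Qbar f J Q `<` Qbar f J Q'.
Proof.
move=> UQ [[[_ _ Q'M] _ _] _] [QQ' nQ'Q]; rewrite !QbarE.
split=> [x|sub]; first exact: QQ'.
have [j Jj nQj] := specU_witness UQ.
have [[_ _ QP] _] := UQ; have [_ _ JM] := ideal_setP J.
apply: nQ'Q => b Q'b.
have : ((snd \o val) @^-1` Q) (amalgam_elt 0 (JM b j Jj)).
  by apply: sub; rewrite /preimage /= rmorph0 add0r mulrC; exact: Q'M.
by rewrite /preimage /= rmorph0 add0r => /QP[].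
Qed.

(** The first projection is onto, since [(a, f a)] is in the amalgamation, so its preimages reflect
    inclusion. *)
Lemma Pprime_proper P P' : P `<` P' -> Pprime f J P `<` Pprime f J P'.
Proof.
move=> [PP' nP'P]; rewrite !PprimeE; split=> [x|sub]; first exact: PP'.
have [J0 _ _] := ideal_setP J.
by apply: nP'P => a P'a; exact: (sub (amalgam_elt a J0)).
Qed.

Lemma Qbar_subset_Pprime Q P : specY f J Q -> Spec A P ->
  Qbar f J Q `<=` Pprime f J P.
Proof.
move=> [[SQ _] /(Qbar_subset_J0 SQ) QJ0] SP.
exact: subset_trans QJ0 (J0_subset_Pprime SP).
Qed.

Lemma Qbar_proper_Pprime Q P : specY f J Q -> Spec A P ->
  Qbar f J Q `<` Pprime f J P.
Proof.
move=> YQ SP; split; first exact: Qbar_subset_Pprime.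
have [j Jj nQj] := specU_witness YQ.1.
(* The pair [(0, j)] with [j] in [J] outside [Q] separates the two primes. *)
move=> /(_ (amalgam_elt 0 Jj)); rewrite QbarE PprimeE /preimage /=.
by rewrite rmorph0 add0r; have [[P0 _ _] _ _] := SP => /(_ P0).
Qed.

Lemma dim_specU_le : (chain_dim (specU J) <= krull_dim (amalgam f J))%E.
Proof.
by apply: chain_dim_mono Qbar_proper => Q [SQ _]; exact: Spec_Qbar.
Qed.

Lemma krull_dim_base_le : (krull_dim A <= krull_dim (amalgam f J))%E.
Proof.
by apply: chain_dim_mono Spec_Pprime _ => P P' _ _; exact: Pprime_proper.
Qed.

Lemma dim_base_delta_le :
  (krull_dim A + 1 + delta f J <= krull_dim (amalgam f J))%E.
Proof.
have [Y0|/set0P Yn0] := eqVneq (specY f J) set0.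
  (* Here [delta] is -1 and cancels the 1, leaving the dimension of [A] alone. *)
  by rewrite /delta Y0 chain_dim0 addeK// krull_dim_base_le.
apply: chain_dim_add_le => //.
  (* Contracting a prime of [specY] along [f] shows that [A] has a prime. *)
  by have [Q [[SQ _] _]] := Yn0; exists (f @^-1` Q); exact: Spec_preimage.
move=> r s P Q cP cQ.
have cQ' : is_chain (Spec (amalgam f J)) s (Qbar f J \o Q).
  apply: is_chain_map cQ => [Q' [[SQ' _] _]|Q1 Q2 [UQ1 _] [UQ2 _]].
    exact: Spec_Qbar.
  exact: Qbar_proper.
have cP' : is_chain (Spec (amalgam f J)) r (Pprime f J \o P).
  apply: is_chain_map cP => [|P1 P2 _ _]; first exact: Spec_Pprime.
  exact: Pprime_proper.
(* The chain from [specY] goes below: its top lies strictly under every [Pprime]. *)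
eexists; apply: is_chain_cat cQ' cP' _.
by apply: Qbar_proper_Pprime; [exact: cQ.1|exact: cP.1].
Qed.

End Amalgam.

Theorem proposition4p4 (A B : comPzRingType) (f : {rmorphism A -> B})
    (J : ideal B) :
  [/\ (forall Q : set B, Spec B Q ->
         f @^-1` (ideal_sum Q J) = [set 0] <-> Qbar f J Q `<=` amalgam_J0 f J),
      (forall Q : set B, specY f J Q ->
         Spec (amalgam f J) (Qbar f J Q) /\
         forall P : set A, Spec A P ->
           Spec (amalgam f J) (Pprime f J P) /\ Qbar f J Q `<=` Pprime f J P)
    & (maxe (chain_dim (specU J)) (krull_dim A + 1 + delta f J)
         <= krull_dim (amalgam f J))%E].
Proof.
split; first exact: Qbar_subset_J0.
- move=> Q YQ; split=> [|P SP]; first exact: Spec_Qbar YQ.1.1.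
  by split; [exact: Spec_Pprime|exact: Qbar_subset_Pprime].
- by rewrite ge_max dim_specU_le dim_base_delta_le.
Qed.
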